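(* Let $d>1$ and let $\mathscr{B}_0,\dots,\mathscr{B}_{m-1}\subset\operatorname{PU}(d)$, where each $\mathscr{B}_a=\{e^a_j\}_{j=0}^{d^2-1}$ is such that $\{U(e^a_j)\}_{j=0}^{d^2-1}$ is a unitary operator basis for $\operatorname{End}(\mathbb{C}^d)$. Suppose there are basis weights $w_0,\dots,w_{m-1}>0$ such that the union $\mathscr{D}=\bigcup_a\mathscr{B}_a$, with weight function $w(x)=\sum_{a}w_a\,1_{\mathscr{B}_a}(x)$, forms a weighted unitary $2$-design. Then $m\ge d^2-1$, and if $m=d^2-1$ then $w_a=1/(md^2)$ for all $a$ and the bases are pairwise mutually unbiased.
   Context: $\operatorname{PU}(d)=\operatorname{U}(d)/\operatorname{U}(1)$, $U(x)$ a representative of $x$, $\mu$ the Haar probability measure. A unitary operator basis is $\{U_j\}_{j=0}^{d^2-1}\subset\operatorname{U}(d)$ with $\operatorname{tr}(U_j^\dagger U_k)=d\delta_{jk}$; two such bases $\{U_j\},\{V_k\}$ are mutually unbiased if $|\operatorname{tr}(U_j^\dagger V_k)|^2=1$ for all $j,k$. $1_{\mathscr{B}}$ denotes the indicator function of $\mathscr{B}$. A weighted unitary $2$-design is a finite $\mathscr{D}\subset\operatorname{PU}(d)$ with weights $w:\mathscr{D}\to(0,1]$, $\sum w=1$, and $\sum_{x\in\mathscr{D}}w(x)U(x)^{\otimes2}\otimes(U(x)^{\otimes2})^\dagger=\int_{\operatorname{PU}(d)}d\mu(x)U(x)^{\otimes2}\otimes(U(x)^{\otimes2})^\dagger$. 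*)

(* Defs.v *)
From HB Require Import structures.
From mathcomp Require Import all_boot all_order all_algebra.
From mathcomp Require Import sesquilinear spectral.
Set Implicit Arguments. Unset Strict Implicit. Unset Printing Implicit Defensive.
Import Order.TTheory GRing.Theory Num.Theory.
Local Open Scope ring_scope.
Local Open Scope sesquilinear_scope.

(* splitting an index of 'I_(m*n) into a pair (same convention as mxvec) *)
Definition mxpair (m n : nat) (k : 'I_(m * n)) : 'I_m * 'I_n :=
  enum_val (cast_ord (esym (mxvec_cast m n)) k).

Definition tensmx {R : pzRingType} (m1 n1 m2 n2 : nat)
  (A : 'M[R]_(m1, n1)) (B : 'M[R]_(m2, n2)) : 'M[R]_(m1 * m2, n1 * n2) :=
  \matrix_(i, j) (A (mxpair i).1 (mxpair j).1 * B (mxpair i).2 (mxpair j).2).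

Definition adjmx {C : numClosedFieldType} (m n : nat) (A : 'M[C]_(m, n))
  : 'M[C]_(n, m) := A ^t*.

Definition rho2 {C : numClosedFieldType} (d : nat) (U : 'M[C]_d)
  : 'M[C]_(d * d * (d * d)) :=
  tensmx (tensmx U U) (adjmx (tensmx U U)).

Definition unitary_operator_basis {C : numClosedFieldType} (d : nat)
  (U : 'I_(d ^ 2) -> 'M[C]_d) : Prop :=
  (forall j, U j \is unitarymx) /\
  (forall j k, \tr (adjmx (U j) *m U k) = if j == k then d%:R else 0).

Definition mutually_unbiased {C : numClosedFieldType} (d : nat)
  (U V : 'I_(d ^ 2) -> 'M[C]_d) : Prop :=
  forall j k, `|\tr (adjmx (U j) *m V k)| ^+ 2 = 1.

(* The degree-(2,2) polynomial functions on U(d) are f_X(U) = tr(X rho2 U),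
   X ranging over d^4 x d^4 matrices.  A Haar integral on this (left
   translation invariant) function space is a linear functional I on them
   (represented through the coefficient matrix X), well defined on functions,
   invariant under left translation U |-> V U, and normalised (integral of the
   constant function 1 is 1).  By uniqueness of invariant means on a finite
   dimensional invariant space of functions containing the constants, this
   determines the Haar integral on these functions. *)
Definition haar_integral22 {C : numClosedFieldType} (d : nat)
  (I : 'M[C]_(d * d * (d * d)) -> C) : Prop :=
  (forall (a : C) X Y, I (a *: X + Y) = a * I X + I Y) /\
  (forall V X Y, V \is unitarymx ->
     (forall U : 'M[C]_d, U \is unitarymx ->
        \tr (Y *m rho2 U) = \tr (X *m rho2 (V *m U))) ->
     I Y = I X) /\
  (forall X, (forall U : 'M[C]_d, U \is unitarymx -> \tr (X *m rho2 U) = 1) ->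
     I X = 1).

(* The matrix  \int dmu(x) U(x)^{(x)2} (x) (U(x)^{(x)2})^dagger , entrywise:
   its (p,q) entry is the integral of U |-> rho2 U p q = tr(E_qp rho2 U). *)
Definition haar_rho2 {C : numClosedFieldType} (d : nat)
  (I : 'M[C]_(d * d * (d * d)) -> C) : 'M[C]_(d * d * (d * d)) :=
  \matrix_(p, q) I (delta_mx q p).

(* Main.v *)
(* For a unitary V, invariance of the design moments gives
     sum_x w(x) |tr(V^* U(x))|^4 = 2  and  sum_x w(x) |tr(V^* U(x))|^2 = 1,
   hence sum_x w(x) (|tr(V^* U(x))|^2 - 1)^2 = 1.  If V belongs to the basis
   B_a, the elements of B_a alone contribute w_a d^2 (d^2 - 1), so this number
   is at most 1.  Summing over the m bases, where the w_a d^2 add up to 1, gives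
   d^2 - 1 <= m; in case of equality every w_a d^2 (d^2 - 1) is 1 and all the
   terms of the other bases vanish, which is mutual unbiasedness. *)
Require Import Defs.
From HB Require Import structures.
From mathcomp Require Import all_boot all_order all_algebra.
From mathcomp Require Import sesquilinear spectral.
From mathcomp Require Import perm ring.
Import Order.TTheory GRing.Theory Num.Theory.
Local Open Scope ring_scope.
Local Open Scope sesquilinear_scope.

(** * Tensor products and the matrices [rho2] *)

Lemma mxpair_index {m n : nat} (i : 'I_m) (j : 'I_n) :
  mxpair (mxvec_index i j) = (i, j).
Proof. by rewrite /mxpair /mxvec_index cast_ordK enum_rankK. Qed.

Lemma mxpairK {m n : nat} (k : 'I_(m * n)) :
  mxvec_index (mxpair k).1 (mxpair k).2 = k.
Proof.
by rewrite /mxpair /mxvec_index -surjective_pairing enum_valK cast_ordKV.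
Qed.

Lemma tensmx_mul {R : comPzRingType} {m1 n1 p1 m2 n2 p2 : nat}
    (A : 'M[R]_(m1, n1)) (B : 'M[R]_(m2, n2))
    (A' : 'M[R]_(n1, p1)) (B' : 'M[R]_(n2, p2)) :
  tensmx A B *m tensmx A' B' = tensmx (A *m A') (B *m B').
Proof.
apply/matrixP => i j; rewrite !mxE (reindex (fun p => mxvec_index p.1 p.2)) /=.
  rewrite big_distrlr pair_bigA /=; apply: eq_bigr => -[k l] _ /=.
  by rewrite !mxE mxpair_index mulrACA.
exists (@mxpair n1 n2) => [[k l] _|k _]; first exact: mxpair_index.
exact: mxpairK.
Qed.

Lemma adjmx_mul {C : numClosedFieldType} {m n p : nat}
    (A : 'M[C]_(m, n)) (B : 'M[C]_(n, p)) :
  adjmx (A *m B) = adjmx B *m adjmx A.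
Proof. by rewrite /adjmx trmx_mul map_mxM. Qed.

(** Left translation by [V] acts on [rho2 U] through fixed matrices on both sides, hence linearly.
    This lets translation invariance pass to weighted sums and to the Haar matrix. *)
Lemma rho2_mul {C : numClosedFieldType} {d : nat} (V U : 'M[C]_d) :
  rho2 (V *m U) =
  tensmx (tensmx V V) 1%:M *m rho2 U *m tensmx 1%:M (adjmx (tensmx V V)).
Proof. by rewrite /rho2 !tensmx_mul mul1mx mulmx1 -adjmx_mul tensmx_mul. Qed.

(** The second tensor factor is an adjoint, so there the row indices [l1], [l2] are column indices
    of [U]. *)
Lemma rho2E {C : numClosedFieldType} {d : nat} (U : 'M[C]_d)
    (i1 i2 k1 k2 j1 j2 l1 l2 : 'I_d) :
  rho2 U (mxvec_index (mxvec_index i1 i2) (mxvec_index l1 l2))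
         (mxvec_index (mxvec_index j1 j2) (mxvec_index k1 k2)) =
  U i1 j1 * U i2 j2 * (U k1 l1 * U k2 l2)^*.
Proof. by rewrite /rho2 /adjmx mxE !mxpair_index /= !mxE !mxpair_index. Qed.

(** * The Haar functional and left invariance *)

Lemma mxtrace_delta {R : comPzRingType} {m n : nat} (A : 'M[R]_(m, n)) p q :
  \tr (delta_mx q p *m A) = A p q.
Proof.
rewrite /mxtrace (bigD1 q) //= big1 ?addr0 => [|i /negPf ne]; rewrite mxE (bigD1 p) //=;
  rewrite big1 ?addr0 ?mxE ?eqxx ?ne ?mul1r ?mul0r // => k /negPf ne';
  by rewrite mxE ne' andbF mul0r.
Qed.

Lemma haar_rho2_trace {C : numClosedFieldType} {d : nat}
    (I : 'M[C]_(d * d * (d * d)) -> C) X :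
  haar_integral22 I -> I X = \tr (X *m haar_rho2 I).
Proof.
case=> lin _.
have I0 : I 0 = 0.
  have := lin 1 0 0; rewrite scaler0 addr0 mul1r => /eqP.
  by rewrite -subr_eq subrr => /eqP <-.
have Isum (J : finType) (F : J -> 'M_(d * d * (d * d))) :
    I (\sum_j F j) = \sum_j I (F j).
  apply: (big_morph I _ I0) => A B.
  by rewrite -[A in LHS]scale1r lin mul1r.
rewrite [X in LHS]matrix_sum_delta Isum /mxtrace; apply: eq_bigr => i _.
rewrite Isum mxE; apply: eq_bigr => j _.
by rewrite -[_ *: _]addr0 lin I0 addr0 mxE.
Qed.

(** The (p,q) entry on the left is [I] applied to a coefficient matrix of the function
    [U |-> rho2 (V *m U) p q], the translate of an entry function, so left invariance of [I] applies
    entry by entry. *)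
Lemma haar_rho2_translate {C : numClosedFieldType} {d : nat}
    (I : 'M[C]_(d * d * (d * d)) -> C) (V : 'M[C]_d) :
  haar_integral22 I -> V \is unitarymx ->
  tensmx (tensmx V V) 1%:M *m haar_rho2 I *m tensmx 1%:M (adjmx (tensmx V V))
  = haar_rho2 I.
Proof.
move=> hI Vu; apply/matrixP => p q; rewrite -mxtrace_delta !mulmxA mxtrace_mulC !mulmxA.
rewrite -haar_rho2_trace // [RHS]mxE; case: (hI) => _ [inv _].
by apply: (inv V) => // U _; rewrite rho2_mul !mulmxA [RHS]mxtrace_mulC !mulmxA.
Qed.

(** The form in which the design property enters all moment computations: a condition on the finite
    weighted family alone, free of the Haar functional. *)
Definition left_invariant22 {C : numClosedFieldType} {d : nat} {T : finType}
    (w : T -> C) (U : T -> 'M[C]_d) : Prop :=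
  forall V : 'M[C]_d, V \is unitarymx ->
  \sum_x w x *: rho2 (V *m U x) = \sum_x w x *: rho2 (U x).

Lemma design_left_invariant {C : numClosedFieldType} {d : nat} {T : finType}
    (w : T -> C) (U : T -> 'M[C]_d) (I : 'M[C]_(d * d * (d * d)) -> C) :
  haar_integral22 I -> \sum_x w x *: rho2 (U x) = haar_rho2 I ->
  left_invariant22 w U.
Proof.
move=> hI hU V Vu; rewrite hU -[RHS](haar_rho2_translate I V) // -hU.
rewrite mulmx_sumr mulmx_suml; apply: eq_bigr => x _.
by rewrite rho2_mul -scalemxAr -scalemxAl.
Qed.

(** * Test unitaries and the commutant of the operators V (x) V *)

Lemma sum_two_entries {R : pzRingType} {n : nat} (v f : 'I_n -> R) c c' s t :
  (forall p, v p = c * (p == s)%:R + c' * (p == t)%:R) ->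
  \sum_p v p * f p = c * f s + c' * f t.
Proof.
move=> vE; under eq_bigr do rewrite vE mulrDl -!mulrA.
have pick (e : R) q : \sum_p e * ((p == q)%:R * f p) = e * f q.
  rewrite (bigD1 q) //= big1 => [|p /negPf->]; last by rewrite mul0r mulr0.
  by rewrite addr0 eqxx mul1r.
by rewrite big_split /= !pick.
Qed.

Lemma unitarymx_diag {C : numClosedFieldType} {n : nat} (r : 'rV[C]_n) :
  (forall i, r 0 i * (r 0 i)^* = 1) -> diag_mx r \is unitarymx.
Proof.
move=> r1; apply/unitarymxP; rewrite tr_diag_mx map_diag_mx mulmx_diag.
by apply/matrixP => i j; rewrite !mxE r1.
Qed.

Lemma unitarymx_perm {C : numClosedFieldType} {n : nat} (s : 'S_n) :
  perm_mx s \is @unitarymx C n n.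
Proof.
by apply/unitarymxP; rewrite tr_perm_mx map_perm_mx -perm_mxM mulgV perm_mx1.
Qed.

(* The Householder reflection along e_s + 2 e_t has rational entries, so no
   square root is involved. *)
Definition reflection_mx {C : numClosedFieldType} {n : nat} (s t : 'I_n) : 'M[C]_n :=
  let v := delta_mx 0 s + 2 *: delta_mx 0 t : 'rV[C]_n in
  1%:M - (2 / 5) *: (v^T *m v).

Lemma reflection_mxE {C : numClosedFieldType} {n : nat} (s t i j : 'I_n) :
  @reflection_mx C n s t i j = (i == j)%:R -
   2 / 5 * (((i == s)%:R + 2 * (i == t)%:R) * ((j == s)%:R + 2 * (j == t)%:R)).
Proof. by rewrite !mxE big_ord1 !mxE !eqxx. Qed.

Lemma reflection_unitarymx {C : numClosedFieldType} {n : nat} (s t : 'I_n) :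
  s != t -> @reflection_mx C n s t \is unitarymx.
Proof.
move=> /negPf st; apply/unitarymxP.
(* The matrix is real and symmetric, so unitarity amounts to being an involution. *)
have -> : (@reflection_mx C n s t)^T ^ Num.conj = reflection_mx s t.
  apply/matrixP => i j; rewrite mxE [_^T _ _]mxE !reflection_mxE.
  rewrite !(rmorph_nat, rmorphB, rmorphM, rmorphD, fmorphV) eq_sym.
  by congr (_ - _ * _); rewrite mulrC.
set v : 'rV[C]_n := delta_mx 0 s + 2 *: delta_mx 0 t.
(* The squared norm is 1 + 4 because [s != t]. Hence A A = 5 A, and (1 - (2/5) A)^2 = 1. *)
have v5 : v *m v^T = 5%:M.
  apply/matrixP => i j; rewrite !ord1 mxE.
  rewrite (@sum_two_entries _ _ (v 0) (fun p => v^T p 0) 1 2 s t); last first.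
    by move=> p; rewrite !mxE eqxx mul1r.
  by rewrite !mxE !eqxx st (eq_sym t) st /=; ring.
rewrite /reflection_mx -/v; set A := v^T *m v.
have AA : A *m A = 5 *: A.
  by rewrite mulmxA -[v^T *m v *m _]mulmxA v5 mul_mx_scalar scalemxAl.
rewrite mulmxBl mul1mx mulmxBr mulmx1 -scalemxAl -scalemxAr AA.
clearbody A; apply/matrixP => i j; rewrite !mxE; by field; rewrite ?pnatr_eq0.
Qed.

(* The commutant of the operators V (x) V is spanned by the identity and the
   flip: diagonal unitaries with entries 1 and 'i kill the entries outside the
   two index patterns, permutations make the rest constant off the diagonal
   i = j, and a reflection mixing two basis vectors fixes the value there. *)
Lemma commutant22 {C : numClosedFieldType} {d : nat}
    (T : 'I_d -> 'I_d -> 'I_d -> 'I_d -> C) :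
  (1 < d)%N ->
  (forall V : 'M[C]_d, V \is unitarymx -> forall i j k l, T i j k l =
     \sum_s (V l s)^* * \sum_r (V k r)^* * \sum_q V j q * \sum_p V i p * T p q r s) ->
  exists a b, forall i j k l,
    T i j k l = a * ((i == k) && (j == l))%:R + b * ((i == l) && (j == k))%:R.
Proof.
move=> d2 inv.
have diag (r : 'rV[C]_d) i j k l : (forall i, r 0 i * (r 0 i)^* = 1) ->
    T i j k l = (r 0 l)^* * (r 0 k)^* * r 0 j * r 0 i * T i j k l.
  move=> r1; rewrite [LHS](inv _ (unitarymx_diag _ r1)).
  (* A row with one nonzero entry is put in the two-entry form with second coefficient 0. *)
  have E a p : diag_mx r a p = r 0 a * (p == a)%:R + 0 * (p == a)%:R.
    by rewrite mxE mul0r addr0 eq_sym mulr_natr.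
  have E' a p : (diag_mx r a p)^* = (r 0 a)^* * (p == a)%:R + 0 * (p == a)%:R.
    by rewrite E !mul0r !addr0 rmorphM rmorph_nat.
  by rewrite (sum_two_entries _ _ _ _ _ _ (E' l)) (sum_two_entries _ _ _ _ _ _ (E' k))
     (sum_two_entries _ _ _ _ _ _ (E j))
    (sum_two_entries _ _ _ _ _ _ (E i)) !mul0r !addr0 !mulrA.
(* The entry picks up 'i for each occurrence of [s] among i, j and -'i for each one among k, l. *)
have phase s i j k l : T i j k l =
    (if l == s then -'i else 1) * (if k == s then -'i else 1) *
    (if j == s then 'i else 1) * (if i == s then 'i else 1) * T i j k l.
  pose r : 'rV[C]_d := \row_i (if i == s then 'i else 1).
  have rE a : (r 0 a)^* = if a == s then -'i else 1.
    by rewrite mxE; case: eqP; rewrite ?conjCi ?conjC1.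
  rewrite {1}(diag r) => [|a].
    by rewrite !rE !mxE.
  by rewrite rE mxE; case: eqP; rewrite ?mulr1 // mulrN -expr2 sqrCi opprK.
have zero c x : c != 1 -> x = c * x -> x = 0 :> C.
  move=> c1 /eqP; rewrite -subr_eq0 -{1}[x]mul1r -mulrBl mulf_eq0 subr_eq0 eq_sym.
  by rewrite (negPf c1) => /eqP.
have m1 : -1 != 1 :> C.
  by rewrite eq_sym -subr_eq0 opprK (_ : 1 + 1 = 2%:R) ?pnatr_eq0.
have i1 : 'i != 1 :> C.
  by apply: contra m1 => /eqP e; rewrite -sqrCi e expr1n.
have iN : (- 'i) * 'i = 1 :> C by rewrite mulNr -expr2 sqrCi opprK.
(* If {i,j} and {k,l} differ as multisets, some index occurs more often in the first; taking it as
   [s] gives the phase 'i or -1, which is not 1. *)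
have Tzero i j k l : ~~ ((i == k) && (j == l) || (i == l) && (j == k)) -> T i j k l = 0.
  have [->|ik] := eqVneq i k; last have [->|il] := eqVneq i l.
  - rewrite negb_or => /andP [jl _]; apply: zero (phase j _ _ _ _).
    rewrite eqxx [l == j]eq_sym (negPf jl : (j == l) = false) mul1r.
    by case: (k == j); rewrite ?mul1r ?mulr1 // mulrAC iN mul1r.
  - rewrite /= => jk; apply: zero (phase j _ _ _ _).
    rewrite eqxx [k == j]eq_sym (negPf jk) mulr1.
    by case: (l == j); rewrite ?mul1r ?mulr1 // iN mul1r.
  move=> _; apply: zero (phase i _ _ _ _).
  rewrite eqxx [k == i]eq_sym [l == i]eq_sym (negPf ik) (negPf il) !mul1r.
  by case: (j == i); rewrite -?expr2 ?sqrCi ?mul1r.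
have permT (s : 'S_d) i j k l : T i j k l = T (s i) (s j) (s k) (s l).
  rewrite (inv _ (unitarymx_perm s)).
  have E a p : @perm_mx C d s a p = 1 * (p == s a)%:R + 0 * (p == a)%:R.
    by rewrite !mxE mul0r addr0 eq_sym mul1r.
  have E' a p : (@perm_mx C d s a p)^* = 1 * (p == s a)%:R + 0 * (p == a)%:R.
    by rewrite E !mul0r !addr0 !mul1r rmorph_nat.
  by rewrite (sum_two_entries _ _ _ _ _ _ (E' l)) (sum_two_entries _ _ _ _ _ _ (E' k))
     (sum_two_entries _ _ _ _ _ _ (E j))
    (sum_two_entries _ _ _ _ _ _ (E i)) !mul0r !addr0 !mul1r.
(* Row [s] of the reflection is (3/5, -4/5) on s, t. With T t t t t = T s s s s, invariance at
   (s,s,s,s) reads (1 - 81/625 - 256/625) T s s s s = (288/625) (T s t s t + T s t t s); this is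
   where 625/288 comes from. *)
have reflT s t : s != t -> T s s s s = T s t s t + T s t t s.
  move=> st.
  have E p : @reflection_mx C d s t s p = 3/5 * (p == s)%:R + (- (4/5)) * (p == t)%:R.
    rewrite reflection_mxE eqxx (negPf st) (eq_sym s p) /=.
    by field; rewrite ?pnatr_eq0.
  have E' p : (@reflection_mx C d s t s p)^* =
      3/5 * (p == s)%:R + (- (4/5)) * (p == t)%:R.
    by rewrite E !(rmorph_nat, rmorphN, rmorphM, rmorphD, fmorphV).
  have := inv _ (reflection_unitarymx s t st) s s s s.
  rewrite !(sum_two_entries _ _ _ _ _ _ E') !(sum_two_entries _ _ _ _ _ _ E).
  have ts := eq_sym t s; rewrite (negPf st) in ts.
  have Z := (Tzero s s s t, Tzero s s t s, Tzero s t s s, Tzero t s s s,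
    Tzero s s t t, Tzero t t s s,
    Tzero s t t t, Tzero t s t t, Tzero t t s t, Tzero t t t s).
  rewrite !Z ?eqxx ?(negPf st) ?ts //.
  rewrite [T t t t t](permT (tperm s t)) [T t s t s](permT (tperm s t)).
  rewrite [T t s s t](permT (tperm s t)) !tpermL !tpermR.
  move=> /eqP; rewrite -subr_eq0 => /eqP e; apply/eqP; rewrite -subr_eq0.
  apply/eqP; rewrite -(mulr0 (625 / 288)) -e; by field; rewrite ?pnatr_eq0.
pose s0 := Ordinal (ltnW d2); pose s1 := Ordinal d2.
(* Permutations act transitively on ordered pairs of distinct indices: first send s0 to i, then the
   image of s1 to j, which leaves i fixed. *)
have mv i j : i != j -> exists s : 'S_d, s s0 = i /\ s s1 = j.
  move=> ij; exists (tperm s0 i * tperm (tperm s0 i s1) j)%g.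
  rewrite !permM tpermL; split; last by rewrite tpermL.
  have ne : tperm s0 i s1 != i by rewrite -{2}(tpermL s0 i) (inj_eq perm_inj).
  by apply: tpermD => //; rewrite eq_sym.
exists (T s0 s1 s0 s1), (T s0 s1 s1 s0) => i j k l.
have st i' j' : i' != j' ->
    T i' j' i' j' = T s0 s1 s0 s1 /\ T i' j' j' i' = T s0 s1 s1 s0.
  by move=> /mv [s [<- <-]]; rewrite -!permT.
have [ijkl|/[dup] /Tzero -> ] :=
    boolP ((i == k) && (j == l) || (i == l) && (j == k)); last first.
  by rewrite negb_or => /andP [/negPf -> /negPf ->]; rewrite !mulr0 addr0.
have [eij|nij] := eqVneq i j.
  have [ek el] : i = k /\ i = l.
    by case/orP: ijkl => /andP [/eqP <- /eqP <-]; split.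
  rewrite -eij -ek -el !eqxx !mulr1.
  have [t it] : exists t, i != t.
    have [-> | ?] := eqVneq i s0; first by exists s1.
    by exists s0.
  by rewrite (reflT _ _ it); have [-> ->] := st _ _ it.
have [es et] := st _ _ nij.
have nji : (j == i) = false by rewrite eq_sym (negPf nij).
case/orP: ijkl => /andP [/eqP <- /eqP <-];
  by rewrite ?es ?et !eqxx ?nji ?(negPf nij) mulr0 mulr1 ?addr0 ?add0r.
Qed.

(** * Fourth-order moments of a left-invariant family *)

(** Column indices come first: once they are fixed, what remains is a four-index tensor in the row
    indices, the only ones that left multiplication touches, ready for [commutant22]. *)
Definition moment22 {C : numClosedFieldType} {d : nat} {T : finType}
    (w : T -> C) (U : T -> 'M[C]_d) (j1 j2 l1 l2 i1 i2 k1 k2 : 'I_d) : C :=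
  \sum_x w x * U x i1 j1 * U x i2 j2 * (U x k1 l1)^* * (U x k2 l2)^*.

Lemma moment22_rho2 {C : numClosedFieldType} {d : nat} {T : finType}
    (w : T -> C) (U : T -> 'M[C]_d) j1 j2 l1 l2 i1 i2 k1 k2 :
  moment22 w U j1 j2 l1 l2 i1 i2 k1 k2 =
  (\sum_x w x *: rho2 (U x)) (mxvec_index (mxvec_index i1 i2) (mxvec_index l1 l2))
         (mxvec_index (mxvec_index j1 j2) (mxvec_index k1 k2)).
Proof.
rewrite summxE; apply: eq_bigr => x _.
by rewrite [RHS]mxE rho2E rmorphM !mulrA.
Qed.

Lemma moment22_invariant {C : numClosedFieldType} {d : nat} {T : finType}
    (w : T -> C) (U : T -> 'M[C]_d) (V : 'M[C]_d) j1 j2 l1 l2 i1 i2 k1 k2 :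
  left_invariant22 w U -> V \is unitarymx ->
  moment22 w (fun x => V *m U x) j1 j2 l1 l2 i1 i2 k1 k2 =
  moment22 w U j1 j2 l1 l2 i1 i2 k1 k2.
Proof. by move=> inv Vu; rewrite !moment22_rho2 inv. Qed.

Lemma moment22_mul {C : numClosedFieldType} {d : nat} {T : finType}
    (w : T -> C) (U : T -> 'M[C]_d) (V : 'M[C]_d) j1 j2 l1 l2 i j k l :
  moment22 w (fun x => V *m U x) j1 j2 l1 l2 i j k l =
  \sum_s (V l s)^* * \sum_r (V k r)^* * \sum_q V j q * \sum_p V i p *
     moment22 w U j1 j2 l1 l2 p q r s.
Proof.
(* Used once for each of the four factors: it expands the last factor, moves the coefficients of [V]
   outside, and puts the entry of [U] in front, so that the next factor to expand becomes last. *)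
have pull (g : T -> C) (v : 'I_d -> C) (u : T -> 'I_d -> C) :
    \sum_x g x * (\sum_p v p * u x p) = \sum_p v p * \sum_x u x p * g x.
  under eq_bigr do rewrite mulr_sumr.
  rewrite exchange_big; apply: eq_bigr => p _; rewrite mulr_sumr.
  by apply: eq_bigr => x _; rewrite mulrC mulrA.
have pullU b g v : \sum_x g x * (\sum_p v p * U x p b) =
    \sum_p v p * \sum_x U x p b * g x by exact: (pull g v (fun x p => U x p b)).
have pullc b g v : \sum_x g x * (\sum_p v p * (U x p b)^*) =
    \sum_p v p * \sum_x (U x p b)^* * g x by exact: (pull g v (fun x p => (U x p b)^*)).
have VU x a b : (V *m U x) a b = \sum_p V a p * U x p b by rewrite mxE.
have VUc x a b : ((V *m U x) a b)^* = \sum_p (V a p)^* * (U x p b)^*.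
  by rewrite VU rmorph_sum; apply: eq_bigr => p _; rewrite rmorphM.
rewrite /moment22; under eq_bigr do rewrite (VUc _ l l2).
rewrite (pullc l2); apply: eq_bigr => s _; congr (_ * _).
under eq_bigr do rewrite mulrA (VUc _ k l1).
rewrite (pullc l1); apply: eq_bigr => r _; congr (_ * _).
under eq_bigr do rewrite !mulrA (VU _ j j2).
rewrite (pullU j2); apply: eq_bigr => q _; congr (_ * _).
under eq_bigr do rewrite !mulrA (VU _ i j1).
rewrite (pullU j1); apply: eq_bigr => p _; congr (_ * _).
by apply: eq_bigr => x _; ring.
Qed.

Lemma unitarymx_col {C : numClosedFieldType} {d : nat} (U : 'M[C]_d) j l :
  U \is unitarymx -> \sum_i U i j * (U i l)^* = (j == l)%:R.
Proof.
rewrite -trmx_unitary => /unitarymxP /matrixP /(_ j l).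
by rewrite !mxE => <-; apply: eq_bigr => i _; rewrite !mxE.
Qed.

Lemma sum_delta {R : pzSemiRingType} {n : nat} (f : 'I_n -> R) (s : 'I_n) :
  \sum_p f p * (p == s)%:R = f s.
Proof.
by rewrite (bigD1 s) //= big1 ?eqxx ?mulr1 ?addr0 // => p /negPf->; rewrite mulr0.
Qed.

Lemma natr_sqr_neq1 {C : numDomainType} {d : nat} :
  (1 < d)%N -> (d%:R : C) != 0 /\ (d%:R ^+ 2 - 1 : C) != 0.
Proof.
move=> d2; split; first by rewrite pnatr_eq0 -lt0n ltnW.
by rewrite subr_eq0 -natrX pnatr_eq1 gtn_eqF // -(exp1n 2) ltn_exp2r.
Qed.

Lemma sum_pair_const {R : pzSemiRingType} {n : nat} (c : R) :
  \sum_(i < n) \sum_(j < n) c = c * n%:R ^+ 2.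
Proof. by rewrite !sumr_const card_ord -mulrnA mulnn -natrX mulr_natr. Qed.

Lemma sum_pair_delta {R : pzSemiRingType} {n : nat} (c : R) :
  \sum_(i < n) \sum_(j < n) c * (j == i)%:R = c * n%:R.
Proof.
under eq_bigr do rewrite sum_delta.
by rewrite sumr_const card_ord mulr_natr.
Qed.

(* Only left invariance is used: it leaves two unknown coefficients, which are
   found by contracting with U^* U = 1 in the two possible ways. *)
Lemma moment22_weingarten {C : numClosedFieldType} {d : nat} {T : finType}
    (w : T -> C) (U : T -> 'M[C]_d) j1 j2 l1 l2 i1 i2 k1 k2 :
  (1 < d)%N -> \sum_x w x = 1 -> (forall x, U x \is unitarymx) ->
  left_invariant22 w U ->
  let D : C := d%:R ^+ 2 in
  let straight : C := ((j1 == l1) && (j2 == l2))%:R in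
  let crossed : C := ((j1 == l2) && (j2 == l1))%:R in
  moment22 w U j1 j2 l1 l2 i1 i2 k1 k2 =
  ((D * straight - d%:R * crossed) * ((i1 == k1) && (i2 == k2))%:R +
   (D * crossed - d%:R * straight) * ((i1 == k2) && (i2 == k1))%:R) / (D * (D - 1)).
Proof.
move=> d2 w1 Uu inv D straight crossed.
have [V Vu i j k l|a [b E]] := commutant22 (moment22 w U j1 j2 l1 l2) d2.
  by rewrite -moment22_mul moment22_invariant.
have sumS : \sum_i \sum_j moment22 w U j1 j2 l1 l2 i j i j = straight.
  rewrite /moment22; under eq_bigr do rewrite exchange_big.
  rewrite exchange_big -[straight]mul1r -w1 mulr_suml; apply: eq_bigr => x _ /=.
  rewrite /straight -mulnb natrM -!(unitarymx_col (U x)) //.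
  rewrite big_distrlr /= mulr_sumr; apply: eq_bigr => i _; rewrite mulr_sumr.
  by apply: eq_bigr => j _; ring.
have sumX : \sum_i \sum_j moment22 w U j1 j2 l1 l2 i j j i = crossed.
  rewrite /moment22; under eq_bigr do rewrite exchange_big.
  rewrite exchange_big -[crossed]mul1r -w1 mulr_suml; apply: eq_bigr => x _ /=.
  rewrite /crossed -mulnb natrM -!(unitarymx_col (U x)) //.
  rewrite big_distrlr /= mulr_sumr; apply: eq_bigr => i _; rewrite mulr_sumr.
  by apply: eq_bigr => j _; ring.
(* [eS] and [eX] form a 2 by 2 system for a, b with determinant D^2 - d^2 = D (D - 1), nonzero since
   d > 1. *)
have eS : a * D + b * d%:R = straight.
  rewrite -sumS -(sum_pair_const a) -(sum_pair_delta b) -big_split.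
  apply: eq_bigr => i _ /=.
  rewrite -big_split; apply: eq_bigr => j _ /=.
  by rewrite E !eqxx mulr1 [i == j]eq_sym andbb.
have eX : a * d%:R + b * D = crossed.
  rewrite -sumX -(sum_pair_const b) -(sum_pair_delta a) -big_split.
  apply: eq_bigr => i _ /=.
  rewrite -big_split; apply: eq_bigr => j _ /=.
  by rewrite E !eqxx mulr1 [i == j]eq_sym andbb.
have [d0 D1] := @natr_sqr_neq1 C d d2.
rewrite E -eS -eX /D; by field; rewrite d0 andbT.
Qed.

(** * Trace moments of the design *)

(** Invariance removes [V], and the expanded fourth power is a sum of moments of diagonal entries.
    The straight and the crossed index pairing each contribute 1. *)
Lemma design_trace4 {C : numClosedFieldType} {d : nat} {T : finType}
    (w : T -> C) (U : T -> 'M[C]_d) (V : 'M[C]_d) :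
  (1 < d)%N -> \sum_x w x = 1 -> (forall x, U x \is unitarymx) ->
  left_invariant22 w U -> V \is unitarymx ->
  \sum_x w x * (`|\tr (V *m U x)| ^+ 2) ^+ 2 = 2.
Proof.
move=> d2 w1 Uu inv Vu; have [d0 D1] := @natr_sqr_neq1 C d d2.
transitivity (\sum_i \sum_j \sum_k \sum_l moment22 w U i j k l i j k l).
  under [RHS]eq_bigr => i _ do under eq_bigr => j _ do under eq_bigr => k _ do
    under eq_bigr => l _ do rewrite -(moment22_invariant _ _ _ _ _ _ _ _ _ _ _ inv Vu).
  under [RHS]eq_bigr => i _ do under eq_bigr => j _ do under eq_bigr => k _ do
    rewrite /moment22 exchange_big.
  under [RHS]eq_bigr => i _ do under eq_bigr => j _ do rewrite exchange_big.
  under [RHS]eq_bigr => i _ do rewrite exchange_big.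
  rewrite exchange_big; apply: eq_bigr => x _ /=.
  rewrite normCK exprMn !expr2 /mxtrace rmorph_sum -mulrA.
  rewrite mulr_suml mulr_sumr; apply: eq_bigr => i _.
  rewrite mulr_suml 2!mulr_sumr; apply: eq_bigr => j _.
  rewrite mulr_suml 3!mulr_sumr; apply: eq_bigr => k _.
  rewrite !mulr_sumr; apply: eq_bigr => l _.
  by ring.
(* For fixed i, j the sum over k, l selects one term per pairing; the two selected terms coincide
   when i = j, whence the correction. *)
transitivity (\sum_(i < d) \sum_(j < d) (2 / (d%:R ^+ 2 - 1) +
    - (2 * d%:R / (d%:R ^+ 2 * (d%:R ^+ 2 - 1))) * (j == i)%:R : C)).
  apply: eq_bigr => i _; apply: eq_bigr => j _.
  have pick (f : 'I_d -> 'I_d -> C) p q :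
      \sum_k \sum_l f k l * ((p == k) && (q == l))%:R = f p q.
    under eq_bigr => k _ do under eq_bigr => l _ do
      rewrite -mulnb natrM mulrA [p == k]eq_sym [q == l]eq_sym.
    by under eq_bigr do rewrite sum_delta; rewrite sum_delta.
  under eq_bigr => k _ do under eq_bigr => l _ do
    rewrite moment22_weingarten // mulrDl [X in X + _]mulrAC
      [X in _ + X]mulrAC [(i == l) && (j == k)]andbC.
  under eq_bigr => k _ do rewrite big_split /=.
  rewrite big_split /= [X in X + _]pick [X in _ + X]pick !eqxx [i == j]eq_sym !andbb.
  by rewrite /=; field; rewrite D1 d0.
under eq_bigr do rewrite big_split.
rewrite big_split /= sum_pair_const sum_pair_delta; field.
by rewrite D1.
Qed.

(** The second moment becomes a fourth-order one on inserting the factor 1 given by the squared norm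
    of a column of V U. The column [z], of index 1, is an arbitrary choice. *)
Lemma design_trace2 {C : numClosedFieldType} {d : nat} {T : finType}
    (w : T -> C) (U : T -> 'M[C]_d) (V : 'M[C]_d) :
  (1 < d)%N -> \sum_x w x = 1 -> (forall x, U x \is unitarymx) ->
  left_invariant22 w U -> V \is unitarymx ->
  \sum_x w x * `|\tr (V *m U x)| ^+ 2 = 1.
Proof.
move=> d2 w1 Uu inv Vu; have [d0 D1] := @natr_sqr_neq1 C d d2.
pose z := Ordinal d2.
transitivity (\sum_i \sum_p \sum_k moment22 w U i z k z i p k p).
  under [RHS]eq_bigr => i _ do under eq_bigr => j _ do under eq_bigr => k _ do
    rewrite -(moment22_invariant _ _ _ _ _ _ _ _ _ _ _ inv Vu).
  under [RHS]eq_bigr => i _ do under eq_bigr => j _ do rewrite /moment22 exchange_big.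
  under [RHS]eq_bigr => i _ do rewrite exchange_big.
  rewrite exchange_big; apply: eq_bigr => x _ /=.
  have one := unitarymx_col (V *m U x) z z (mul_unitarymx Vu (Uu x)).
  rewrite eqxx in one; rewrite -[LHS]mulr1 -[X in _ * X]one.
  rewrite normCK /mxtrace rmorph_sum mulr_suml [w x * _]mulr_sumr mulr_suml.
  apply: eq_bigr => i _.
  rewrite mulr_sumr; apply: eq_bigr => p _.
  rewrite !(mulr_sumr, mulr_suml); apply: eq_bigr => k _.
  by ring.
transitivity (\sum_(i < d) \sum_(p < d)
    ((d%:R ^+ 2 - d%:R * (i == z)%:R +
      (d%:R ^+ 2 * (i == z)%:R - d%:R) * (p == i)%:R) / (d%:R ^+ 2 * (d%:R ^+ 2 - 1)) : C)).
  apply: eq_bigr => i _; apply: eq_bigr => p _.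
  rewrite (bigD1 i) //= big1 ?addr0 => [|k /negPf ki]; rewrite moment22_weingarten //.
    by rewrite !eqxx [z == i]eq_sym [i == p]eq_sym !andbb /=; ring.
  (* For k != i neither pairing of the column indices (i,z) and (k,z) matches, so only k = i
     survives. *)
  have e q : (i == q) && (q == k) = false.
    by have [<-|] := eqVneq i q; rewrite // eq_sym ki.
  by rewrite !e eqxx andbT [i == k]eq_sym ki /=; ring.
rewrite -[RHS](@divff _ (d%:R ^+ 2 * (d%:R ^+ 2 - 1))) ?mulf_neq0 ?expf_neq0 //.
under eq_bigr do rewrite -mulr_suml big_split /= sum_delta sumr_const card_ord.
rewrite -mulr_suml big_split /=; congr (_ / _).
by rewrite sumrMnl !sumrB !sum_delta !sumr_const card_ord; ring.
Qed.

Lemma design_variance {C : numClosedFieldType} {d : nat} {T : finType}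
    (w : T -> C) (U : T -> 'M[C]_d) (V : 'M[C]_d) :
  (1 < d)%N -> \sum_x w x = 1 -> (forall x, U x \is unitarymx) ->
  left_invariant22 w U -> V \is unitarymx ->
  \sum_x w x * (`|\tr (adjmx V *m U x)| ^+ 2 - 1) ^+ 2 = 1.
Proof.
move=> d2 w1 Uu inv; rewrite -trmxC_unitary => Vu.
have t4 := design_trace4 w U _ d2 w1 Uu inv Vu.
have t2 := design_trace2 w U _ d2 w1 Uu inv Vu.
have E : (\sum_x w x * (`|\tr (V^t* *m U x)| ^+ 2) ^+ 2) -
    2 * (\sum_x w x * `|\tr (V^t* *m U x)| ^+ 2) + \sum_x w x = 1.
  by rewrite t4 t2 w1; ring.
rewrite -[RHS]E mulr_sumr -sumrB -big_split; apply: eq_bigr => x _ /=.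
by rewrite /adjmx; ring.
Qed.

(** * Counting over the bases *)

Theorem theorem5 (C : numClosedFieldType) (d m : nat) (hd : (1 < d)%N)
  (U : 'I_m -> 'I_(d ^ 2) -> 'M[C]_d) (w : 'I_m -> C)
  (hbasis : forall a, unitary_operator_basis (U a))
  (hw : forall a, 0 < w a)
  (hwsum : \sum_(a < m) (d ^ 2)%:R * w a = 1)
  (I : 'M[C]_(d * d * (d * d)) -> C) (hI : haar_integral22 I)
  (hdesign : \sum_(a < m) \sum_(j < d ^ 2) w a *: rho2 (U a j) = haar_rho2 I) :
  (d ^ 2 - 1 <= m)%N /\
  (m = (d ^ 2 - 1)%N ->
     (forall a, w a = ((m * d ^ 2)%:R)^-1) /\
     (forall a b, a != b -> mutually_unbiased (U a) (U b))).
Proof.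
(* The union is indexed by pairs (a,j): a point lying in several bases is repeated, and its weights
   w_a add up as in w(x). *)
pose W (x : 'I_m * 'I_(d ^ 2)) := w x.1.
pose U' (x : 'I_m * 'I_(d ^ 2)) := U x.1 x.2.
have W1 : \sum_x W x = 1.
  rewrite -(pair_bigA _ (fun a _ => w a)) -hwsum; apply: eq_bigr => a _ /=.
  by rewrite sumr_const card_ord mulr_natl.
have Uu x : U' x \is unitarymx by case: (hbasis x.1) => + _; apply.
have inv : left_invariant22 W U'.
  apply: (design_left_invariant _ _ I hI).
  by rewrite -hdesign (pair_bigA _ (fun a j => w a *: rho2 (U a j))).
have [d0 D1] := @natr_sqr_neq1 C d hd.
pose g a j b k := (`|\tr (adjmx (U a j) *m U b k)| ^+ 2 - 1) ^+ 2.
pose r a j := \sum_(b | b != a) \sum_k w b * g a j b k.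
have g_ge0 a j b k : 0 <= g a j b k.
  by rewrite real_exprn_even_ge0 // realB ?realX ?normr_real.
have r_ge0 a j : 0 <= r a j.
  by apply: sumr_ge0 => b _; apply: sumr_ge0 => k _; rewrite mulr_ge0 // ltW.
(* Within its own basis, [U a j] contributes (d^2 - 1)^2 and each of the d^2 - 1 other elements
   contributes (0 - 1)^2 = 1, in total d^2 (d^2 - 1). The other bases give the slack [r a j]. *)
have split1 a j : w a * (d%:R ^+ 2 * (d%:R ^+ 2 - 1)) + r a j = 1.
  rewrite -[RHS](design_variance W U' (U' (a, j)) hd W1 Uu inv (Uu _)).
  rewrite -(pair_bigA _ (fun b k => w b * g a j b k)) /= (bigD1 a) //=; congr (_ + _).
  rewrite -mulr_sumr; congr (_ * _).
  have [_ orth] := hbasis a.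
  rewrite (bigD1 j) //= (eq_bigr (fun=> 1)) => [|k kj]; last first.
    by rewrite /g orth eq_sym (negPf kj) normr0 expr0n sub0r sqrrN expr1n.
  rewrite sumr_const cardC1 card_ord /g orth eqxx normr_nat.
  by rewrite -subn1 natrB ?expn_gt0 ?(ltnW hd) // natrX; ring.
(* Sum of [split1] over all bases with the same j; [hwsum] removes the weights. *)
have total j : d%:R ^+ 2 - 1 + \sum_a r a j = m%:R.
  rewrite -[m in RHS]card_ord -sumr_const.
  under [RHS]eq_bigr => a _ do rewrite -(split1 a j).
  rewrite big_split /= -mulr_suml mulrA; congr (_ + _).
  by rewrite -[_ ^+ 2 in X in _ * X * _]natrX mulrC [X in _ * X]mulrC
    mulr_sumr hwsum mulr1.
have d2_gt0 : (0 < d ^ 2)%N by rewrite expn_gt0 ltnW.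
have dE : d%:R ^+ 2 - 1 = (d ^ 2 - 1)%:R :> C by rewrite natrB // natrX.
split.
  by rewrite -(ler_nat C) -(total (Ordinal d2_gt0)) dE lerDl sumr_ge0.
move=> mE; have r0 a j : r a j = 0.
  apply: (psumr_eq0P (P := xpredT) (F := fun a => r a j)) => //.
  by apply: (addrI (d%:R ^+ 2 - 1)); rewrite total addr0 dE -mE.
split=> [a|a b ab j k].
  have := split1 a (Ordinal d2_gt0); rewrite r0 addr0 dE -mE -natrX -natrM mulnC => wa.
  have md0 : (m * d ^ 2)%:R != 0 :> C.
    by apply: contra_eq_neq wa => ->; rewrite mulr0 eq_sym oner_neq0.
  by apply: (mulIf md0); rewrite wa mulVf.
have ba : b != a by rewrite eq_sym.
(* A vanishing sum of nonnegative terms has vanishing terms. Applied to b and then to k, and with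
   [w b] positive, this forces [g a j b k] to be 0. *)
have row0 : \sum_k w b * g a j b k = 0.
  apply: (psumr_eq0P (P := fun b => b != a) _ (r0 a j)) => // c _.
  by apply: sumr_ge0 => l _; rewrite mulr_ge0 // ltW.
have : w b * g a j b k = 0.
  by apply: (psumr_eq0P (P := xpredT) _ row0) => // l _; rewrite mulr_ge0 // ltW.
move/eqP; rewrite mulf_eq0 gt_eqF //= expf_eq0 /= subr_eq0.
by move/eqP.
Qed.
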